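(* Let $c_1,c_2\in(0,1]$, let $T(x)=c_1(1-2x^2)$ on $[-1,1]$, and assume that $T$ has a physical measure $\mu$. Let $x_0\in[-1,1]$ be any point of the full Lebesgue measure set of points $x$ for which $\frac1n\sum_{i=0}^{n-1}\delta_{T^i x}\to\mu$ weakly, let $y_0\in[-1,1]$, and for $k\in(0,1)$ define, for $n\ge0$, $$x_{n+1}=c_1(1-2x_n^2),\qquad y_{n+1}=(1-k)c_2(1-2y_n^2)+k\,c_1(1-2x_n^2)$$ (so $y_n$ depends on $k$). Let $f:[-1,1]\to\mathbb{R}$ be continuous. (i) Let $\varepsilon>0$, let $\delta_\varepsilon>0$ be such that $|f(x)-f(y)|<\frac{\varepsilon}{2}$ for all $x,y\in[-1,1]$ with $|x-y|<\delta_\varepsilon$, and let $k_\varepsilon\in(0,1)$ with $k_\varepsilon>1-\frac1{4c_1}$ be such that $2W_\infty(k_\varepsilon)<\delta_\varepsilon$. Then for all $k$ with $k_\varepsilon<k<1$, $$\left|\limsup_{n\to\infty}\frac1n\sum_{i=0}^{n-1}f(y_i)-\mu(f)\right|\le\varepsilon .$$ (ii) Consequently, $$\inf_{0<k<1}\left|\limsup_{n\to\infty}\frac1n\sum_{i=0}^{n-1}f(y_i)-\mu(f)\right|=0 .$$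
   Context: A physical measure of $T:[-1,1]\to[-1,1]$ is a Borel probability measure $\mu$ such that for Lebesgue almost every $x\in[-1,1]$ the measures $\frac1n\sum_{i=0}^{n-1}\delta_{T^i x}$ converge weakly to $\mu$ as $n\to\infty$. Notation: $\mu(f)=\int f\,d\mu$. For $k\in(0,1)$ with $k>1-\frac{1}{4c_1}$, $$W_\infty(k):=\frac{|c_1-c_2|(1-k)}{1-4c_1(1-k)} .$$ *)

(* Defs.v *)
From HB Require Import structures.
From mathcomp Require Import all_boot all_order all_algebra.
From mathcomp Require Import all_classical all_reals all_analysis.
Set Implicit Arguments.
Unset Strict Implicit.
Unset Printing Implicit Defensive.
Import Order.TTheory GRing.Theory Num.Theory.
Import numFieldNormedType.Exports.
Local Open Scope classical_set_scope.
Local Open Scope ring_scope.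

(* Maps and test functions on [-1, 1] are total functions on R, of which only
   the values on [-1, 1] matter; Borel measures on [-1, 1] are measures on R
   (with its Borel sigma-algebra) that are concentrated on [-1, 1]. *)
Definition I11 {R : realType} : set R := `[(-1), 1].

(* (1/n) \sum_(i < n) \delta_(T^i x); for n = 0 this is the zero measure since
   0^-1 = 0, which is harmless as only n --> oo matters. *)
Definition empirical {R : realType} (T : R -> R) (x : R) (n : nat) :
    {measure set (measurableTypeR R) -> \bar R} :=
  mscale (n%:R^-1)%:nng
    (msum (fun i => dirac (iter i T x : measurableTypeR R)) n).

Definition weakly_converges {R : realType}
    (nu : nat -> {measure set (measurableTypeR R) -> \bar R})
    (mu : {measure set (measurableTypeR R) -> \bar R}) : Prop :=
  forall g : R -> R, {within I11, continuous g} ->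
    (\int[nu n]_(x in I11) (g x)%:E)%E @[n --> \oo] -->
    (\int[mu]_(x in I11) (g x)%:E)%E.

Definition basin {R : realType} (T : R -> R)
    (mu : probability (measurableTypeR R) R) : set R :=
  [set x | I11 x /\ weakly_converges (empirical T x) mu].

Definition physical_measure {R : realType} (T : R -> R)
    (mu : probability (measurableTypeR R) R) : Prop :=
  mu I11 = 1%E /\
  {ae (@lebesgue_measure R), forall x, I11 x -> basin T mu x}.

Definition quad {R : realType} (c x : R) : R := c * (1 - 2 * x ^+ 2).

Definition drive {R : realType} (c1 x0 : R) (n : nat) : R :=
  iter n (quad c1) x0.

Fixpoint response {R : realType} (c1 c2 k x0 y0 : R) (n : nat) : R :=
  if n is m.+1 then
    (1 - k) * quad c2 (response c1 c2 k x0 y0 m) + k * quad c1 (drive c1 x0 m)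
  else y0.

Definition W_infty {R : realType} (c1 c2 k : R) : R :=
  `|c1 - c2| * (1 - k) / (1 - 4 * c1 * (1 - k)).

(* The limsup is taken in \bar R, so that no junk value can arise. *)
Definition limsup_average {R : realType} (f : R -> R) (y : nat -> R) : \bar R :=
  limn_esup (fun n => (n%:R^-1 * \sum_(i < n) f (y i))%:E).

(* Main.v *)
(* The distance to the drive obeys
     |y_(n+1) - x_(n+1)| <= (1 - k) |c1 - c2| + 4 c1 (1 - k) |y_n - x_n|,
   an affine recursion with ratio q = 4 c1 (1 - k) < 1 and fixed point
   W_infty k, hence |y_n - x_n| <= W_infty k + 2 q^n.  Since W_infty is
   nonincreasing in k, the orbits are eventually delta-close, so the averages of
   f along them eventually differ by at most about eps / 2, while those along x
   converge to mu(f).  For (ii), W_infty k tends to 0 as k tends to 1 and f is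
   uniformly continuous. *)
Require Import Defs.
From HB Require Import structures.
From mathcomp Require Import all_boot all_order all_algebra.
From mathcomp Require Import all_classical all_reals all_analysis.
From mathcomp Require Import measurable_realfun ring lra.
Set Implicit Arguments.
Unset Strict Implicit.
Unset Printing Implicit Defensive.
Import Order.TTheory GRing.Theory Num.Theory.
Import numFieldNormedType.Exports.
Local Open Scope classical_set_scope.
Local Open Scope ring_scope.

(** * Distance between the response and its drive *)

Lemma I11E (R : realType) (x : R) : I11 x = (-1 <= x <= 1).
Proof. by rewrite /I11 /= in_itv. Qed.

Lemma quad_I11 (R : realType) (c x : R) : 0 < c <= 1 -> I11 x -> I11 (quad c x).
Proof.
rewrite !I11E => /andP[c0 c1] /andP[x0 x1]; rewrite /quad.
have h : `|1 - 2 * x ^+ 2| <= 1 by rewrite ler_norml; apply/andP; split; nra.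
by rewrite -ler_norml normrM (gtr0_norm c0) mulr_ile1// ltW.
Qed.

Lemma drive_I11 (R : realType) (c x : R) n :
  0 < c <= 1 -> I11 x -> I11 (drive c x n).
Proof. by move=> hc hx; elim: n => //= n ih; exact: quad_I11. Qed.

Lemma response_I11 (R : realType) (c1 c2 k x y : R) n :
  0 < c1 <= 1 -> 0 < c2 <= 1 -> 0 <= k <= 1 -> I11 x -> I11 y ->
  I11 (response c1 c2 k x y n).
Proof.
move=> h1 h2 /andP[k0 k1] hx hy; elim: n => //= n ih.
have := quad_I11 h2 ih; rewrite I11E => /andP[a1 a2].
have := quad_I11 h1 (drive_I11 n h1 hx); rewrite I11E => /andP[b1 b2].
by rewrite I11E; apply/andP; split; nra.
Qed.

Lemma response_drive_dist (R : realType) (c1 c2 k x y : R) n :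
  0 < c1 <= 1 -> 0 < c2 <= 1 -> 0 <= k <= 1 -> 4 * c1 * (1 - k) < 1 ->
  I11 x -> I11 y ->
  `|response c1 c2 k x y n - drive c1 x n|
    <= W_infty c1 c2 k + 2 * (4 * c1 * (1 - k)) ^+ n.
Proof.
move=> h1 h2 hk hq hx hy.
have [/andP[c10 c11] /andP[k0 k1]] := (h1, hk).
set q := 4 * c1 * (1 - k) in hq *.
have q0 : 0 <= q by rewrite /q; nra.
have W0 : 0 <= W_infty c1 c2 k.
  by rewrite /W_infty divr_ge0 ?mulr_ge0 ?subr_ge0// ltW.
have Wfix : `|c1 - c2| * (1 - k) + q * W_infty c1 c2 k = W_infty c1 c2 k.
  by rewrite /W_infty -/q; field; rewrite gt_eqF// subr_gt0.
elim: n => [|n ih].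
  (* The constant 2 in the bound is the diameter of [I11]. *)
  move: hx hy; rewrite !I11E => /andP[? ?] /andP[? ?].
  by rewrite /drive /= expr0 ler_norml; apply/andP; split; lra.
have := response_I11 n h1 h2 hk hx hy; rewrite I11E => /andP[a1 a2].
have := drive_I11 n h1 hx; rewrite I11E => /andP[b1 b2].
have -> : drive c1 x n.+1 = quad c1 (drive c1 x n) by [].
rewrite [response _ _ _ _ _ _]/=.
move: (response _ _ _ _ _ n) (drive _ _ n) ih a1 a2 b1 b2 => u v ih a1 a2 b1 b2.
(* Insert [quad c1 u]: the parameter mismatch gives the first term, and [u ^+ 2 - v ^+ 2] factors in
   the second, where [|u + v| <= 2] yields the ratio [4 * c1 * (1 - k)]. *)
have -> : (1 - k) * quad c2 u + k * quad c1 v - quad c1 v =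
    (1 - k) * ((c2 - c1) * (1 - 2 * u ^+ 2)) - 2 * c1 * (1 - k) * (u + v) * (u - v).
  by rewrite /quad; ring.
apply: (le_trans (ler_normB _ _)).
(* By the fixed-point identity the target is the image of the inductive bound under the affine
   recursion, so the two terms compare separately. *)
have -> : W_infty c1 c2 k + 2 * q ^+ n.+1 =
    `|c1 - c2| * (1 - k) + q * (W_infty c1 c2 k + 2 * q ^+ n).
  by rewrite -{1}Wfix exprS; ring.
apply: lerD.
  rewrite normrM ger0_norm ?subr_ge0// mulrC ler_wpM2r ?subr_ge0//.
  rewrite normrM distrC ler_piMr// ler_norml; apply/andP; split; nra.
rewrite normrM; apply: ler_pM => //.
rewrite normrM ger0_norm; last by nra.
have : `|u + v| <= 2 by rewrite ler_norml; apply/andP; split; lra.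
rewrite /q; have : 0 <= 2 * c1 * (1 - k) by nra.
by move: `|u + v| => w; nra.
Qed.

(** As [k] grows to 1 the numerator shrinks but stays nonnegative, while the denominator does not
    drop below its positive initial value. *)
Lemma W_infty_nonincreasing (R : realType) (c1 c2 k k' : R) :
  0 < c1 -> k <= k' <= 1 -> 4 * c1 * (1 - k) < 1 ->
  W_infty c1 c2 k' <= W_infty c1 c2 k.
Proof.
move=> c0 /andP[kk k1] q1; rewrite /W_infty.
have q2 : 4 * c1 * (1 - k') < 1 by apply: le_lt_trans q1; nra.
apply: ler_pM.
- by rewrite mulr_ge0// subr_ge0.
- by rewrite invr_ge0 subr_ge0 ltW.
- by rewrite ler_wpM2l// lerB.
- rewrite lef_pV2 ?posrE ?subr_gt0// lerB//; nra.
Qed.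

(** * Averages and upper limits of real sequences *)

Lemma near_normr_average_le (R : realType) (a : nat -> R) (e e' : R) :
  (\forall n \near \oo, `|a n| <= e) -> e < e' ->
  \forall n \near \oo, `|n%:R^-1 * \sum_(i < n) a i| <= e'.
Proof.
move=> [N _ aN] ee'; set C := \sum_(i < N) `|a i|.
(* The first [N] terms cost a constant [C]; every later one costs at most [e]. *)
have bound j : \sum_(i < N + j) `|a i| <= C + j%:R * e.
  elim: j => [|j ih]; first by rewrite addn0 mul0r addr0.
  rewrite addnS big_ord_recr /= -natr1 mulrDl mul1r addrA lerD//.
  by apply: aN => /=; exact: leq_addr.
have e0 : 0 <= e by apply: le_trans (aN N (leqnn N)).
near=> n.
have n0 : 0 < n%:R :> R by rewrite ltr0n; near: n; exists 1%N.
have nN : (N <= n)%N by near: n; exists N.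
rewrite normrM normfV normr_nat ler_pdivrMl//.
apply: (le_trans (ler_norm_sum _ _ _)).
have := bound (n - N)%N; rewrite subnKC// => /le_trans; apply.
(* Past this threshold [C <= n * (e' - e)]: the strict gap absorbs the initial terms. *)
have : C / (e' - e) <= n%:R by near: n; exact: nbhs_infty_ger.
rewrite ler_pdivrMr ?subr_gt0// => h.
have : (n - N)%:R * e <= n%:R * e by rewrite ler_wpM2r// ler_nat leq_subr.
by move: h; lra.
Unshelve. all: by end_near. Qed.

(** Each late tail supremum is at most [m + e], as all its terms are, and at least [m - e], as its
    first term is; both bounds pass to the limit. *)
Lemma normr_limn_esup_sub_le (R : realType) (u : nat -> R) (m e : R) :
  (\forall n \near \oo, `|u n - m| <= e) ->
  (`|limn_esup (fun n => (u n)%:E) - m%:E| <= e%:E)%E.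
Proof.
move=> ume; rewrite limn_esup_lim.
set v := fun n => (u n)%:E.
have hi : (limn (esups v) <= (m + e)%:E)%E.
  apply: lime_le; first exact: is_cvg_esups.
  case: ume => N _ hN; exists N => // n /= Nn.
  apply: ge_ereal_sup => _ [k /= nk <-]; rewrite lee_fin.
  by have := hN k (leq_trans Nn nk); rewrite ler_norml => /andP[_]; rewrite lerBlDl.
have lo : ((m - e)%:E <= limn (esups v))%E.
  apply: lime_ge; first exact: is_cvg_esups.
  case: ume => N _ hN; exists N => // n /= Nn.
  apply: (@le_trans _ _ (u n)%:E).
    by have := hN n Nn; rewrite lee_fin ler_norml => /andP[+ _]; rewrite lerBrDl.
  by apply: ereal_sup_ubound; exists n => /=.
(* The two real bounds exclude infinite values of the limit. *)
case: (limn _) hi lo => [r| |]//; rewrite -EFinB abse_EFin !lee_fin => hi lo.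
by rewrite ler_norml; apply/andP; split; lra.
Qed.

(** * Integration and uniform continuity on [I11] *)

Lemma continuous_I11_measurable (R : realType) (f : R -> R) :
  {within I11, continuous f} ->
  @measurable_fun _ _ (measurableTypeR R) _ I11 (EFin \o f).
Proof.
move=> cf; apply/measurable_EFinP.
by apply: subspace_continuous_measurable_fun => //; exact: measurable_itv.
Qed.

Lemma integral_empirical (R : realType) (T : R -> R) (x : R) (f : R -> R) n :
  {within I11, continuous f} -> (forall i, I11 (iter i T x)) ->
  (\int[empirical T x n]_(z in I11) (f z)%:E)%E =
  (n%:R^-1 * \sum_(i < n) f (iter i T x))%:E.
Proof.
move=> cf hx.
have mI : measurable (I11 : set (measurableTypeR R)) by exact: measurable_itv.
have mf := continuous_I11_measurable cf.
(* Nonnegative integrands come first, where integration is additive in the measure with no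
   integrability condition; the positive and negative parts of [f] follow. *)
have ge0E (g : measurableTypeR R -> \bar R) : measurable_fun I11 g ->
    (forall z, I11 z -> (0 <= g z)%E) ->
    (\int[empirical T x n]_(z in I11) g z =
     n%:R^-1%:E * \sum_(i < n) g (iter i T x))%E.
  move=> mg g0; rewrite /empirical ge0_integral_mscale//; congr (_ * _)%E.
  rewrite ge0_integral_measure_sum//; apply: eq_bigr => i _.
  by rewrite integral_dirac// diracE mem_set// mul1e.
rewrite integralE !ge0E//; [|exact: measurable_funeneg|exact: measurable_funepos].
rewrite (eq_bigr (fun i : 'I_n => (Num.max (f (iter i T x)) 0)%:E)); last first.
  by move=> i _; rewrite funeposE -EFin_max.
rewrite [X in (_ - _ * X)%E](eq_bigr
    (fun i : 'I_n => (Num.max (- f (iter i T x)) 0)%:E)); last first.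
  by move=> i _; rewrite funenegE -EFin_max.
rewrite !sumEFin -!EFinM -EFinB -mulrBr -sumrB; congr (_ * _)%:E.
(* Pointwise, [max(a, 0) - max(-a, 0) = a]. *)
apply: eq_bigr => i _; rewrite !maxEle.
by case: ifPn; case: ifPn; lra.
Qed.

(** A continuous function on a compact interval is bounded, hence integrable for a finite measure;
    so the limit in weak convergence is a real number. *)
Lemma integral_I11_fin_num (R : realType)
    (mu : probability (measurableTypeR R) R) (f : R -> R) :
  {within I11, continuous f} -> (\int[mu]_(x in I11) (f x)%:E)%E \is a fin_num.
Proof.
move=> cf.
have mI : measurable (I11 : set (measurableTypeR R)) by exact: measurable_itv.
apply: integrable_fin_num => //.
apply: (@measurable_bounded_integrable _ (measurableTypeR R) R mu f I11 mI).
- by apply: le_lt_trans (probability_le1 mu mI) _; rewrite ltry.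
- by apply/measurable_EFinP; exact: continuous_I11_measurable.
- have := compact_bounded (continuous_compact cf (@segment_compact _ _ _)).
  by move=> [M [Mr hM]]; exists M; split => // y My z Iz; apply: hM => //; exists z.
Qed.

(** Heine-Cantor, with compactness in near-covering form: a bound valid near each point for all
    small [d] becomes uniform over [I11]. *)
Lemma continuous_I11_unif (R : realType) (f : R -> R) (e : R) :
  {within I11, continuous f} -> 0 < e ->
  exists2 d, 0 < d & forall x y, I11 x -> I11 y -> `|x - y| < d ->
    `|f x - f y| < e.
Proof.
move=> cf e0.
have : \forall d \near (0 : R)^'+, I11 `<=` [set x | forall y, I11 y ->
    `|x - y| < d -> `|f x - f y| < e].
  have /compact_near_coveringP/near_covering_withinP := @segment_compact R (-1) 1.
  apply => x Ix.
  have : \forall y \near within I11 (nbhs x), `|f x - f y| < e / 2.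
    move/subspace_continuousP: cf => /(_ x Ix).
    by move=> /cvgrPdist_lt; apply; rewrite divr_gt0.
  move=> /nbhs_ballP[r /= r0 hr].
  (* Halving [r] keeps [y] in the ball of radius [r] about [x], so [f x'] and [f y] are both within
     [e / 2] of [f x]. *)
  exists (ball x (r / 2), [set d | d < r / 2]) => /=.
    split; first by apply: nbhsx_ballx; rewrite divr_gt0.
    by apply: nbhs_right_lt; rewrite divr_gt0.
  move=> [x' d] /= [xx' dr] Ix' y Iy x'y.
  have xx'e : `|f x - f x'| < e / 2.
    by apply: hr => //; apply: le_ball xx'; lra.
  have xye : `|f x - f y| < e / 2.
    apply: hr => //; rewrite /ball /=.
    apply: le_lt_trans (ler_distD x' x y) _.
    by move: xx'; rewrite /ball /= => xx'; lra.
  by apply: le_lt_trans (ler_distD (f x) _ _) _; rewrite distrC; lra.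
move=> h; have [d []] : exists d, d > 0 /\ I11 `<=` [set x | forall y, I11 y ->
    `|x - y| < d -> `|f x - f y| < e].
  near (0 : R)^'+ => d; exists d; split => //.
  by near: d.
by move=> d0 hd; exists d => // x y Ix Iy; exact: hd.
Unshelve. all: by end_near. Qed.

(** * The two claims about the averages *)

Lemma limsup_average_response_le (R : realType) (c1 c2 : R)
    (mu : probability (measurableTypeR R) R) (x0 y0 : R) (f : R -> R)
    (eps delta keps k : R) :
  0 < c1 <= 1 -> 0 < c2 <= 1 -> basin (quad c1) mu x0 -> I11 y0 ->
  {within I11, continuous f} -> 0 < eps ->
  (forall x y : R, I11 x -> I11 y -> `|x - y| < delta ->
     `|f x - f y| < eps / 2) ->
  0 < keps -> 1 - (4 * c1)^-1 < keps -> 2 * W_infty c1 c2 keps < delta ->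
  0 < delta -> keps < k < 1 ->
  (`|limsup_average f (response c1 c2 k x0 y0)
     - \int[mu]_(x in I11) (f x)%:E| <= eps%:E)%E.
Proof.
move=> h1 h2 [Ix0 wc] Iy0 cf e0 fd ke0 keq kW d0 /andP[kk k1].
have [/andP[c10 c11] /andP[c20 c21]] := (h1, h2).
have hk : 0 <= k <= 1 by apply/andP; split; lra.
have qe : 4 * c1 * (1 - keps) < 1.
  have c4 : 0 < 4 * c1 by lra.
  by rewrite mulrC -ltr_pdivlMr// div1r; lra.
have qk : 4 * c1 * (1 - k) < 1 by apply: le_lt_trans qe; nra.
have Wk : W_infty c1 c2 k < delta / 2.
  have /le_lt_trans : W_infty c1 c2 k <= W_infty c1 c2 keps.
    by apply: W_infty_nonincreasing => //; apply/andP; split; lra.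
  by apply; lra.
set x := drive c1 x0; set y := response c1 c2 k x0 y0.
have Ix n : I11 (x n) by exact: drive_I11.
have Iy n : I11 (y n) by exact: response_I11.
(* Half of [delta] covers [W_infty]; the other half covers [2 * q ^+ n] once [q ^+ n < delta / 4],
   where [q] is [4 * c1 * (1 - k)]. *)
have close : \forall n \near \oo, `|y n - x n| < delta.
  have : (4 * c1 * (1 - k)) ^+ n @[n --> \oo] --> (0 : R).
    by apply: cvg_expr; rewrite ger0_norm//; nra.
  move=> /cvgrPdist_lt/(_ (delta / 4)) hq.
  have /hq : 0 < delta / 4 by lra.
  apply: filterS => n; rewrite sub0r normrN => hn.
  apply: le_lt_trans (response_drive_dist n h1 h2 hk qk Ix0 Iy0) _.
  by move: hn; rewrite ltr_norml => /andP[_]; lra.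
have [m mE] : exists m, (\int[mu]_(x in I11) (f x)%:E)%E = m%:E.
  by have /fineK <- := integral_I11_fin_num mu cf; eexists.
(* Budget: [eps / 4] for convergence along the drive and [3 / 4 * eps] for the averaged
   response-drive difference, which leaves a strict gap above the pointwise [eps / 2]. *)
have Ax : \forall n \near \oo, `|n%:R^-1 * \sum_(i < n) f (x i) - m| < eps / 4.
  have := wc f cf; rewrite mE.
  under eq_fun do rewrite integral_empirical//.
  move=> /fine_cvgP[_] /cvgrPdist_lt/(_ (eps / 4)) h.
  have /h : 0 < eps / 4 by lra.
  by apply: filterS => n; rewrite distrC.
have Ayx : \forall n \near \oo,
    `|n%:R^-1 * \sum_(i < n) (f (y i) - f (x i))| <= 3 / 4 * eps.
  apply: (@near_normr_average_le _ (fun i => f (y i) - f (x i)) (eps / 2)); last by lra.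
  by apply: filterS close => n yx; apply/ltW/fd => //.
rewrite mE; apply: normr_limn_esup_sub_le.
apply: filterS2 Ax Ayx => n Ax Ayx.
rewrite sumrB mulrBr in Ayx.
have := ler_normD (n%:R^-1 * \sum_(i < n) f (y i) - n%:R^-1 * \sum_(i < n) f (x i))
  (n%:R^-1 * \sum_(i < n) f (x i) - m).
by rewrite addrA subrK; lra.
Qed.

Theorem proposition3p1 (R : realType) (c1 c2 : R)
    (hc1 : 0 < c1 <= 1) (hc2 : 0 < c2 <= 1)
    (mu : probability (measurableTypeR R) R)
    (hmu : physical_measure (quad c1) mu)
    (x0 : R) (hx0 : basin (quad c1) mu x0)
    (y0 : R) (hy0 : I11 y0)
    (f : R -> R) (hf : {within I11, continuous f}) :
  (forall eps delta keps : R,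
     0 < eps ->
     0 < delta ->
     (forall x y : R, I11 x -> I11 y -> `|x - y| < delta ->
        `|f x - f y| < eps / 2) ->
     0 < keps < 1 ->
     1 - (4 * c1)^-1 < keps ->
     2 * W_infty c1 c2 keps < delta ->
     forall k : R, keps < k < 1 ->
       (`|limsup_average f (response c1 c2 k x0 y0)
          - \int[mu]_(x in I11) (f x)%:E| <= eps%:E)%E) /\
  ereal_inf [set (`|limsup_average f (response c1 c2 k x0 y0)
                    - \int[mu]_(x in I11) (f x)%:E|)%E
            | k in `]0, 1[%classic] = 0%E.
Proof.
split=> [eps delta keps e0 d0 fd /andP[ke0 _] keq kW k kk|].
  exact: (limsup_average_response_le hc1 hc2 hx0 hy0 hf e0 fd ke0 keq kW d0 kk).
apply/eqP; rewrite eq_le; apply/andP; split; last first.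
  by apply: le_ereal_inf_tmp => _ [k _ <-]; exact: abse_ge0.
apply/lee_addgt0Pr => eps e0; rewrite add0e.
have [|delta d0 fd] := continuous_I11_unif hf (e := eps / 2); first by lra.
have [/andP[c10 c11] /andP[c20 c21]] := (hc1, hc2).
(* [s] is [1 - keps]: [s <= 1 / 8] makes the denominator of [W_infty] at least [1 / 2], so
   [W_infty <= 2 * s], and [s <= delta / 8] then gives [2 * W_infty <= delta / 2]. The witness
   [k = 1 - s / 2] lies between [keps] and 1. *)
set s := Num.min (1 / 8) (delta / 8).
have s0 : 0 < s by rewrite lt_min; apply/andP; split; lra.
have [s8 sd] : s <= 1 / 8 /\ s <= delta / 8.
  by split; rewrite ge_min lexx ?orbT.
have D1 : `|c1 - c2| <= 1 by rewrite ler_norml; apply/andP; split; lra.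
apply: ge_ereal_inf; exists (`|limsup_average f (response c1 c2 (1 - s / 2) x0 y0)
    - \int[mu]_(x in I11) (f x)%:E|)%E.
  by exists (1 - s / 2) => //=; rewrite in_itv /=; apply/andP; split; lra.
apply: (limsup_average_response_le hc1 hc2 hx0 hy0 hf e0 fd (keps := 1 - s)) => //.
- by lra.
- rewrite ltrD2l ltrN2; apply: (@lt_le_trans _ _ (4^-1)); first by lra.
  by rewrite lef_pV2 ?posrE; lra.
- have W2 : W_infty c1 c2 (1 - s) <= 2 * s.
    rewrite /W_infty opprB addrCA subrr addr0 ler_pdivrMr; last by nra.
    have := ler_wpM2r (ltW s0) D1; nra.
  by lra.
- by apply/andP; split; lra.
Qed.
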